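(* Let $(U_t)_{t\in\mathbb{R}}$ be a reflection positive unitary one-parameter group on the reflection positive Hilbert space $(\mathcal{E},\mathcal{E}_+,\theta)$ for which $\mathcal{E}_0=\{v\in\mathcal{E}_+:\theta v=v\}$ is $U$-cyclic, and write $P:\mathcal{E}\to\mathcal{E}_0$ for the orthogonal projection. Then the following are equivalent: (i) $q(\mathcal{E}_0)=\widehat{\mathcal{E}}$, i.e., $\Gamma:=q|_{\mathcal{E}_0}:\mathcal{E}_0\to\widehat{\mathcal{E}}$ is unitary. (ii) The function $\varphi:\mathbb{R}\to B(\mathcal{E}_0)$, $\varphi(t):=PU_tP^*$, is multiplicative on $\mathbb{R}_+ = ]0,\infty[$, i.e., $\varphi(s+t)=\varphi(s)\varphi(t)$ for $s,t>0$. (iii) The orthogonal projections $P_+$ onto $\mathcal{E}_+$, $P_0$ onto $\mathcal{E}_0$, and $P_-$ onto $\theta(\mathcal{E}_+)$ satisfy the Markov condition $P_+P_0P_-=P_+P_-$. If this is the case, then: (a) $\varphi(t)=\Gamma^*\widehat U_{|t|}\Gamma$ for $t\in\mathbb{R}$. In particular, $\Gamma$ intertwines $\varphi|_{\mathbb{R}_+}$ with $\widehat U$. (b) $\mathcal{E}=\mathcal{N}\oplus\mathcal{E}_0\oplus\theta(\mathcal{N})$ is an orthogonal decomposition, and $\mathcal{E}_+$ is maximal $\theta$-positive, i.e., maximal among the $\theta$-positive subspaces of $\mathcal{E}$. (c) $\mathcal{E}_+$ is the closed subspace generated by $\bigcup_{t>0}U_t\mathcal{E}_0$.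
   Context: A reflection positive Hilbert space is a triple $(\mathcal{E},\mathcal{E}_+,\theta)$, where $\mathcal{E}$ is a complex Hilbert space, $\theta$ is a unitary involution on $\mathcal{E}$ and $\mathcal{E}_+\subseteq\mathcal{E}$ is a closed subspace which is $\theta$-positive: $\langle\theta v,v\rangle\ge 0$ for all $v\in\mathcal{E}_+$. Put $\mathcal{N}=\{v\in\mathcal{E}_+:\langle\theta v,v\rangle=0\}$, let $\widehat{\mathcal{E}}$ be the Hilbert space completion of $\mathcal{E}_+/\mathcal{N}$ with respect to the norm $\|\widehat v\|=\sqrt{\langle\theta v,v\rangle}$, and let $q:\mathcal{E}_+\to\widehat{\mathcal{E}}$, $v\mapsto\widehat v$, be the canonical map; $q$ is isometric on $\mathcal{E}_0$. A reflection positive unitary one-parameter group on $(\mathcal{E},\mathcal{E}_+,\theta)$ is a strongly continuous unitary one-parameter group $(U_t)_{t\in\mathbb{R}}$ on $\mathcal{E}$ with $U_t\mathcal{E}_+\subseteq\mathcal{E}_+$ for $t>0$ and $\theta U_t\theta=U_{-t}$ for $t\in\mathbb{R}$. It induces a strongly continuous semigroup $(\widehat U_t)_{t\ge0}$ of self-adjoint contractions on $\widehat{\mathcal{E}}$ with $\widehat U_t\widehat v=\widehat{U_tv}$ for $v\in\mathcal{E}_+$. A subspace is $U$-cyclic if its translates under all $U_t$, $t\in\mathbb{R}$, span a dense subspace of $\mathcal{E}$. Here $P$ is regarded as a map $\mathcal{E}\to\mathcal{E}_0$, so $P^*:\mathcal{E}_0\to\mathcal{E}$ is the inclusion, while $P_0=P^*P\in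 B(\mathcal{E})$. *)

(* Defs.v *)
From HB Require Import structures.
From mathcomp Require Import all_boot all_order all_algebra.
From mathcomp Require Import sesquilinear complex.
From mathcomp Require Import all_classical all_reals all_analysis.

Set Implicit Arguments.
Unset Strict Implicit.
Unset Printing Implicit Defensive.

Import Order.TTheory GRing.Theory Num.Theory numFieldNormedType.Exports.

Local Open Scope classical_set_scope.
Local Open Scope complex_scope.
Local Open Scope ring_scope.

(* Complex Hilbert spaces: a complete normed space over R[i] whose norm comes
   from an inner product, linear in its first argument and conjugate-linear in
   its second one. *)
HB.mixin Record CompleteNormedModule_isHilbert (R : realType) E
    of CompleteNormedModule R[i] E := {
  hdot : {dot E for (@Num.conj R[i])} ;
  hdot_norm : forall v : E, `|v| ^+ 2 = hdot v v
}.

#[short(type="hilbertType")]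
HB.structure Definition Hilbert (R : realType) :=
  {E of CompleteNormedModule_isHilbert R E & CompleteNormedModule R[i] E}.

Notation "''[' u , v ]" := (hdot u%R v%R)
  (at level 0, format "''[' u ,  v ]") : ring_scope.

Section Hilbert_definitions.
Context {R : realType}.
Implicit Types E F : hilbertType R.

Definition linear_subspace E (A : set E) : Prop :=
  A 0 /\ forall (a : R[i]) (u v : E), A u -> A v -> A (a *: u + v).

Definition closed_subspace E (A : set E) : Prop := linear_subspace A /\ closed A.

Definition lspan E (S : set E) : set E := smallest (@linear_subspace E) S.

Definition closed_lspan E (S : set E) : set E :=
  smallest (@closed_subspace E) S.

(* An operator defined on a subspace A of E is encoded by a total function on
   E, whose values outside of A are irrelevant. *)
Definition linear_on E F (A : set E) (T : E -> F) : Prop :=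
  forall (a : R[i]) (u v : E), A u -> A v -> T (a *: u + v) = a *: T u + T v.

Definition unitary_on E F (A : set E) (T : E -> F) : Prop :=
  [/\ linear_on A T,
      forall v w, A v -> A w -> '[T v, T w] = '[v, w] &
      T @` A = setT].

Definition unitary E F (T : E -> F) : Prop := unitary_on setT T.

(* The projection theorem gives, for a closed subspace A, existence and
   uniqueness of the point selected here. *)
Definition orthproj E (A : set E) (x : E) : E :=
  xget 0 [set y | A y /\ forall w, A w -> '[x - y, w] = 0].

(* The adjoint F -> A of a bounded operator T : A -> F on a closed subspace A
   of E; the selected point exists and is unique by Riesz's theorem. *)
Definition adjoint_on E F (A : set E) (T : E -> F) (y : F) : E :=
  xget 0 [set x | A x /\ forall w, A w -> '[x, w] = '[y, T w]].

Definition orthogonal_sets E (A B : set E) : Prop :=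
  forall v w, A v -> B w -> '[v, w] = 0.

Definition orthogonal_decomposition3 E (A B C : set E) : Prop :=
  [/\ [/\ closed_subspace A, closed_subspace B & closed_subspace C],
      [/\ orthogonal_sets A B, orthogonal_sets A C & orthogonal_sets B C] &
      forall x, exists a b c, [/\ A a, B b, C c & x = a + b + c]].

End Hilbert_definitions.

Section reflection_positivity.
Context {R : realType}.
Implicit Types E F : hilbertType R.

Definition theta_positive E (theta : E -> E) (A : set E) : Prop :=
  forall v, A v -> 0 <= '[theta v, v].

Definition maximal_theta_positive E (theta : E -> E) (A : set E) : Prop :=
  [/\ linear_subspace A, theta_positive theta A &
      forall B, linear_subspace B -> theta_positive theta B ->
        A `<=` B -> B = A].

Record reflection_positive_space E (theta : E -> E) (Ep : set E) : Prop := {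
  rps_unitary : unitary theta ;
  rps_involutive : involutive theta ;
  rps_closed_subspace : closed_subspace Ep ;
  rps_positive : theta_positive theta Ep
}.

Definition fixed_part E (theta : E -> E) (Ep : set E) : set E :=
  [set v | Ep v /\ theta v = v].

Definition null_part E (theta : E -> E) (Ep : set E) : set E :=
  [set v | Ep v /\ '[theta v, v] = 0].

(* (F, q) is a Hilbert space completion of Ep / N for the norm
   sqrt '[theta v, v]: the kernel of q on Ep is N, so that q factors through
   an isometric embedding of Ep / N with dense range in the complete space F.
   This determines (F, q) up to a unique unitary isomorphism. *)
Record is_completion E F (theta : E -> E) (Ep : set E) (q : E -> F) : Prop := {
  completion_linear : linear_on Ep q ;
  completion_norm : forall v, Ep v -> `|q v| = sqrtC '[theta v, v] ;
  completion_dense : dense (q @` Ep)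
}.

Record unitary_one_parameter_group E (U : R -> E -> E) : Prop := {
  group_unitary : forall t, unitary (U t) ;
  group0 : U 0 = id ;
  groupD : forall s t, U (s + t) = U s \o U t ;
  group_strongly_continuous : forall v, continuous (U ^~ v)
}.

Record reflection_positive_group E (theta : E -> E) (Ep : set E)
    (U : R -> E -> E) : Prop := {
  rpg_group : unitary_one_parameter_group U ;
  rpg_invariant : forall t, 0 < t -> U t @` Ep `<=` Ep ;
  rpg_reflection : forall t, theta \o U t \o theta = U (- t)
}.

Definition cyclic_subspace E (U : R -> E -> E) (A : set E) : Prop :=
  dense (lspan (\bigcup_t (U t @` A))).

(* The bounded operator on F determined, for 0 <= t, by q v |-> q (U t v) on
   the dense subspace q(Ep). *)
Definition induced_semigroup E F (Ep : set E) (q : E -> F) (U : R -> E -> E)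
    (t : R) : F -> F :=
  @xget (F -> F) id [set T : F -> F | [/\ linear T, continuous T &
                                    forall v, Ep v -> T (q v) = q (U t v)]].

(* phi(t) = P U_t P^* as an operator on A, where P : E -> A is the orthogonal
   projection and P^* the inclusion of A. *)
Definition compression E (A : set E) (U : R -> E -> E) (t : R) : E -> E :=
  orthproj A \o U t.

End reflection_positivity.

(* Main.v *)
Require Import Defs.
From mathcomp Require Import all_boot all_order all_algebra.
From mathcomp Require Import sesquilinear complex.
From mathcomp Require Import all_classical all_reals all_analysis.
From mathcomp Require Import ring lra.

(** Write [E0] for the fixed part of [Ep], [N] for its null part and [P0] for
    the orthogonal projection to [E0].  The conditions are readings of one
    statement, called [markov] below: a vector of [Ep] orthogonal to [E0] is
    orthogonal to all of [theta Ep].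

    - Surjectivity of [q] on [E0].  Since [q] carries the form
      ['[theta v, w]] to the inner product of the completion and is isometric
      on [E0], the vectors of [Ep] orthogonal to [E0] have to be null; a null
      vector is orthogonal to [theta Ep] because the form is positive
      ([neutral_orthogonal]).  Conversely, [markov] gives [q v = q (P0 v)] on
      [Ep], so [q E0 = q Ep] is dense, and it is complete
      ([markov_completion]).

    - The projection identity.  On [theta w] with [w] in [Ep] it says that
      [theta w - P0 (theta w)] is orthogonal to [Ep]
      ([markov_projections]).

    - Multiplicativity.  The equation for [s] and [t] says that
      [U t v - P0 (U t v)] is orthogonal to [U (- s) w = theta (U s w)] for
      [v] and [w] in [E0].  It follows from [markov] for [Ep], and it implies
      [markov] for the closed span [K] of the [U t E0] with [0 < t].

    The remaining gap, from [K] to [Ep], is closed by maximality.  A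
    [markov] space [K] such that [K] and [theta K] together span a dense
    subspace gives [E = N + E0 + theta N] orthogonally
    ([markov_decomposition]); for [v] in a larger theta-positive space,
    [theta v] is orthogonal to the neutral space [N], so that [v] has no
    component in [theta N] and lies in [K] ([markov_maximal]).  Cyclicity of
    [E0] provides the density for every [K] containing the [U t E0] with
    [0 <= t].  Hence [Ep = K], which proves both the missing implication and
    (c); applied to [Ep] itself the same two lemmas give (b).

    For (a), [U t] with [0 <= t] preserves the null vectors, so that
    [q v |-> q (U t v)] is a well defined contraction once every vector of
    the completion is [q e] with [e] in [E0], and [q (P0 (U t v)) =
    q (U t v)]. *)

Set Implicit Arguments.
Unset Strict Implicit.

Import Order.TTheory GRing.Theory Num.Theory numFieldNormedType.Exports.

Local Open Scope classical_set_scope.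
Local Open Scope complex_scope.
Local Open Scope ring_scope.

(** * Inner products *)

Section inner_product.
Context {R : realType} {E : hilbertType R}.
Implicit Types (u v w x y : E) (a c : R[i]).

Lemma dotDl u v w : '[u + v, w] = '[u, w] + '[v, w].
Proof. exact: linearDl. Qed.

Lemma dotDr u v w : '[u, v + w] = '[u, v] + '[u, w].
Proof. exact: linearDr. Qed.

Lemma dotBl u v w : '[u - v, w] = '[u, w] - '[v, w].
Proof. exact: linearBl. Qed.

Lemma dotBr u v w : '[u, v - w] = '[u, v] - '[u, w].
Proof. exact: linearBr. Qed.

Lemma dotNr u v : '[u, - v] = - '[u, v].
Proof. exact: linearNr. Qed.

Lemma dot0l v : '[0 : E, v] = 0.
Proof. exact: linear0l. Qed.

Lemma dot0r v : '[v, 0 : E] = 0.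
Proof. exact: linear0r. Qed.

Lemma dotZl a u v : '[a *: u, v] = a * '[u, v].
Proof. exact: linearZl_LR. Qed.

Lemma dotZr a u v : '[u, a *: v] = Num.conj a * '[u, v].
Proof. exact: linearZr_LR. Qed.

Lemma dotC u v : '[u, v] = Num.conj '[v, u].
Proof. by rewrite (hermC hdot) /= expr0 mul1r. Qed.

Lemma dot_eq0C u v : '[u, v] = 0 -> '[v, u] = 0.
Proof. by move=> uv0; rewrite dotC uv0 conjC0. Qed.

Lemma dot_ge0 u : 0 <= '[u, u].
Proof. by rewrite -hdot_norm exprn_ge0. Qed.

Lemma dot_eq0 u : '[u, u] = 0 -> u = 0.
Proof.
by move=> /eqP; rewrite -hdot_norm expf_eq0 /= normr_eq0 => /eqP.
Qed.

(** Subtracting from [u] its component along [v]; both the Cauchy-Schwarz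
    inequality and the orthogonality of a nearest point are read off from
    this norm. *)
Lemma dot_residual u v : v != 0 ->
  let c := '[u, v] / '[v, v] in
  '[u - c *: v, u - c *: v] = '[u, u] - `|'[u, v]| ^+ 2 / '[v, v].
Proof.
move=> v0; have vv0 : '[v, v] != 0.
  by apply: contraNneq v0 => /dot_eq0 ->.
have vvJ : Num.conj '[v, v] = '[v, v] by rewrite -dotC.
rewrite /= dotBl !dotBr !dotZl !dotZr fmorph_div /= vvJ normCK -(dotC v u).
by field.
Qed.

Lemma cauchy_schwarz u v : `|'[u, v]| <= `|u| * `|v|.
Proof.
have [->|v0] := eqVneq v 0; first by rewrite dot0r !normr0 mulr0.
have vv0 : 0 < '[v, v] by rewrite -hdot_norm exprn_gt0 // normr_gt0.
rewrite -(@ler_pXn2r _ 2) ?nnegrE // ?mulr_ge0 // exprMn !hdot_norm.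
by rewrite -ler_pdivrMr // -subr_ge0 -dot_residual // dot_ge0.
Qed.

Lemma continuous_dotl w : continuous (fun v : E => '[v, w]).
Proof.
move=> v; apply/cvgrPdist_lt => e e0.
(* One is added to [`|w|] to be able to divide by it when [w = 0]. *)
have K0 : 0 < `|w| + 1 by rewrite ltr_wpDl.
near=> z.
rewrite -dotBl (le_lt_trans (cauchy_schwarz _ _)) //.
rewrite (@le_lt_trans _ _ (`|v - z| * (`|w| + 1))) //.
  by rewrite ler_wpM2l // lerDl.
rewrite -ltr_pdivlMr //; near: z.
by apply: cvgr_dist_lt => //; rewrite divr_gt0.
Unshelve. all: by end_near. Qed.

Definition perp (A : set E) : set E :=
  [set x | forall w, A w -> '[x, w] = 0].

(** Orthogonality to a set is how the subspaces below are shown to be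
    closed, and how inclusions of closed spans are proved. *)
Lemma closed_subspace_perp (A : set E) : closed_subspace (perp A).
Proof.
split; first split=> [w _|a u v Au Av w Aw].
- exact: dot0l.
- by rewrite dotDl dotZl Au // Av // mulr0 addr0.
suff -> : perp A = \bigcap_(w in A) ((fun v => '[v, w]) @^-1` [set 0]).
  apply: closed_bigI => w _; apply: preimage_closed => [v _|].
    exact: continuous_dotl.
  exact: accessible_closed_set1 (hausdorff_accessible (@norm_hausdorff _ _)) _.
by [].
Qed.

Lemma closed_dense_eqT {T : topologicalType} (A B : set T) :
  closed A -> dense B -> B `<=` A -> A = setT.
Proof.
move=> clA dB BA; apply/seteqP; split=> // x _; apply: contrapT => nAx.
have [||y [nAy By]] := dB (~` A); first by exists x.
  exact: closed_openC.
exact: nAy (BA y By).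
Qed.

Lemma perp_dense_eq0 (A : set E) x :
  dense (lspan A) -> (forall w, A w -> '[x, w] = 0) -> x = 0.
Proof.
move=> dA xA; apply: dot_eq0.
have [lin cl] := closed_subspace_perp [set x].
have : perp [set x] = setT.
  apply: closed_dense_eqT cl dA _ => y; apply.
  by split=> // w Aw _ ->; apply: dot_eq0C; exact: xA.
by move=> /seteqP[_ /(_ x I)]; apply.
Qed.

End inner_product.

(** * The projection theorem *)

Section projection.
Context {R : realType} {E : hilbertType R}.
Implicit Types (u v w x y : E) (A : set E).

(** Radii of balls are positive elements of [R[i]], hence real; this brings
    them back to [R], where infima and Archimedean estimates live. *)
Lemma gt0_real (e : R[i]) : 0 < e -> exists2 r : R, 0 < r & e = r%:C.
Proof.
move=> e0; exists (complex.Re e); last by rewrite RRe_real // gtr0_real.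
by rewrite -ltcR RRe_real // gtr0_real.
Qed.

Lemma Re_dot u : '[u, u] = (complex.Re '[u, u])%:C.
Proof. by rewrite RRe_real // ger0_real // dot_ge0. Qed.

Lemma parallelogram u v :
  '[u - v, u - v] = 2 * '[u, u] + 2 * '[v, v] - '[u + v, u + v].
Proof. by rewrite !dotDl !dotDr !(linearNl, linearNr) /=; ring. Qed.

(** Otherwise removing from [z] its component along [w] would shorten it. *)
Lemma minimal_orthogonal z w :
  (forall c, '[z, z] <= '[z - c *: w, z - c *: w]) -> '[z, w] = 0.
Proof.
have [->|w0] := eqVneq w 0; first by rewrite dot0r.
have ww0 : 0 < '[w, w] by rewrite -hdot_norm exprn_gt0 // normr_gt0.
move=> /(_ ('[z, w] / '[w, w])); rewrite dot_residual // lerBrDr gerDl => le0.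
have : `|'[z, w]| ^+ 2 / '[w, w] = 0.
  by apply/le_anti; rewrite le0 divr_ge0 // exprn_ge0.
move/eqP; rewrite mulf_eq0 invr_eq0 (gt_eqF ww0) orbF expf_eq0 /= normr_eq0.
by move/eqP.
Qed.

Lemma subspaceZ A (c : R[i]) u : linear_subspace A -> A u -> A (c *: u).
Proof. by move=> [A0 AL] Au; rewrite -[_ *: _]addr0; exact: AL. Qed.

Lemma subspaceD A u v : linear_subspace A -> A u -> A v -> A (u + v).
Proof. by move=> [A0 AL] Au Av; rewrite -[u]scale1r; exact: AL. Qed.

Lemma subspaceN A u : linear_subspace A -> A u -> A (- u).
Proof. by move=> lA Au; rewrite -scaleN1r; exact: subspaceZ. Qed.

Lemma subspaceB A u v : linear_subspace A -> A u -> A v -> A (u - v).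
Proof. by move=> lA Au Av; apply: subspaceD => //; exact: subspaceN. Qed.

(** The point is the limit of a minimizing sequence for the distance from
    [x] to [A]: by the parallelogram identity, applied to two terms whose
    midpoint is again in [A], such a sequence is Cauchy. *)
Lemma projection_theorem A x : closed_subspace A ->
  exists y, A y /\ perp A (x - y).
Proof.
move=> [lA clA].
pose N u := complex.Re '[u, u].
have NE u : '[u, u] = (N u)%:C by exact: Re_dot.
have N_ge0 u : 0 <= N u by have := dot_ge0 u; rewrite NE ler0c.
pose D := [set N (x - a) | a in A].
have D_lb : has_lbound D by exists 0 => _ [a _ <-].
have D_inf : has_inf D by split=> //; exists (N (x - 0)), 0 => //; case: lA.
pose d := inf D.
have d_le a : A a -> d <= N (x - a) by move=> Aa; apply: ge_inf => //; exists a.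
have /choice[a aP] n : exists a, A a /\ N (x - a) < d + n.+1%:R^-1.
  have [|_ [a Aa <-] ?] := @inf_adherent _ D n.+1%:R^-1 _ D_inf.
    by rewrite invr_gt0.
  by exists a.
have dist n m : N (a n - a m) <= 2 * n.+1%:R^-1 + 2 * m.+1%:R^-1.
  have [[An ltn] [Am ltm]] := (aP n, aP m).
  have /d_le : A (2^-1 *: (a n + a m)).
    by apply: subspaceZ => //; exact: subspaceD.
  have -> : N (a n - a m) = 2 * N (x - a n) + 2 * N (x - a m) -
      4 * N (x - 2^-1 *: (a n + a m)).
    apply: complexI; rewrite !(rmorphD, rmorphM) -!NE.
    have -> : a n - a m = (x - a m) - (x - a n).
      by rewrite opprB [x - _ + _]addrC addrA subrK.
    rewrite parallelogram.
    have -> : x - a m + (x - a n) = 2 *: (x - 2^-1 *: (a n + a m)).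
      rewrite scalerBr scalerA divff // scale1r scaler_nat mulr2n.
      by rewrite addrACA -opprD (addrC (a m)).
    rewrite rmorphN rmorphM /= -!NE dotZl dotZr conjC_nat.
    by rewrite !rmorph_nat; ring.
  move=> le_d; rewrite lerBlDr.
  apply: le_trans (lerD (ler_wpM2l _ (ltW ltn)) (ler_wpM2l _ (ltW ltm))) _;
    rewrite //.
  by move: le_d; set p := N _; set i := n.+1%:R^-1; set j := m.+1%:R^-1; lra.
have cv : cvg (a @ \oo).
  apply/cauchy_cvgP/cauchy_ballP => _ /gt0_real[r r0 ->].
  have r24 : 0 < r ^+ 2 / 4 by rewrite divr_gt0 ?exprn_gt0.
  near \oo => K.
  pose tail := [set a n | n in [set n | (K <= n)%N]].
  exists (tail, tail).
    by split; exists K => // n Kn; exists n.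
  move=> [_ _] /= [[n Kn <-] [m Km <-]].
  rewrite -ball_normE /=.
  rewrite -(@ltr_pXn2r _ 2) ?nnegrE // ?ler0c ?ltW //.
  rewrite hdot_norm NE -rmorphXn ltcR (le_lt_trans (dist n m)) //.
  have le_inv k : (K <= k)%N -> (k.+1%:R^-1 : R) <= K.+1%:R^-1.
    by move=> Kk; rewrite lef_pV2 ?posrE // ler_nat.
  suff : K.+1%:R^-1 < r ^+ 2 / 4.
    move: (le_inv _ Kn) (le_inv _ Km).
    set i := n.+1%:R^-1; set j := m.+1%:R^-1; set k := K.+1%:R^-1; lra.
  near: K; exact: (near_infty_natSinv_lt (PosNum r24)).
have Ay : A (lim (a @ \oo)).
  by apply: (closed_cvg _ clA _ _ cv); apply: nearW => n; case: (aP n).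
set y := lim (a @ \oo) in Ay.
have y_min : '[x - y, x - y] <= d%:C.
  apply/ler_addgt0Pr => _ /gt0_real[r r0 ->].
  have d_ge0 : 0 <= d by apply: lb_le_inf; [case: D_inf | move=> _ [b _ <-]].
  have s0 : 0 <= (d + r)%:C by rewrite ler0c addr_ge0 // ltW.
  rewrite -rmorphD /= -[(d + r)%:C]sqrtCK -hdot_norm.
  rewrite ler_pXn2r ?nnegrE ?sqrtC_ge0 //.
  apply/ler_addgt0Pr => e' e'0.
  near \oo => n.
  rewrite -[x - y](subrKA (a n)) (le_trans (ler_normD _ _)) // lerD //.
    rewrite -[leLHS]ger0_norm // -(@ler_pXn2r _ 2) ?nnegrE ?sqrtC_ge0 //.
    rewrite sqrtCK normr_id hdot_norm NE lecR.
    have [_ /ltW ltn] := aP n; apply: (le_trans ltn); rewrite lerD2l ltW //.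
    near: n; exact: (near_infty_natSinv_lt (PosNum r0)).
  apply: ltW; rewrite distrC; near: n.
  exact: cvgr_dist_lt.
exists y; split=> // w Aw.
apply: minimal_orthogonal => c.
rewrite (le_trans y_min) // NE lecR -addrA -opprD.
by apply: d_le; apply: subspaceD => //; exact: subspaceZ.
Unshelve. all: by end_near. Qed.
End projection.

Section projection_operator.
Context {R : realType} {E : hilbertType R}.
Implicit Types (u v w x y : E) (A : set E).

Lemma orthproj_exists A x : (exists y, A y /\ perp A (x - y)) ->
  A (orthproj A x) /\ perp A (x - orthproj A x).
Proof. exact: (@xgetPex _ 0 [set y | A y /\ perp A (x - y)]). Qed.

Lemma orthprojP A x : closed_subspace A ->
  A (orthproj A x) /\ perp A (x - orthproj A x).
Proof. by move=> cA; apply: orthproj_exists; exact: projection_theorem. Qed.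

Lemma orthproj_eq A x y : linear_subspace A ->
  A y -> perp A (x - y) -> orthproj A x = y.
Proof.
move=> lA Ay xy.
have [Az xz] := orthproj_exists (ex_intro _ y (conj Ay xy)).
apply/eqP; rewrite -subr_eq0; apply/eqP/dot_eq0.
have Ad : A (orthproj A x - y) by exact: subspaceB.
have {1}-> : orthproj A x - y = (x - y) - (x - orthproj A x).
  by rewrite opprB [RHS]addrC subrKA.
by rewrite dotBl xz // xy // subrr.
Qed.

Lemma closed_subspaceI A B :
  closed_subspace A -> closed_subspace B -> closed_subspace (A `&` B).
Proof.
move=> [[A0 AL] cA] [[B0 BL] cB]; split; last exact: closedI.
by split=> // a u v [? ?] [? ?]; split; [exact: AL | exact: BL].
Qed.

Lemma closed_subspace_closed_lspan (S : set E) :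
  closed_subspace (closed_lspan S).
Proof.
split; last by apply: closed_bigI => A [[_ cA] _].
split=> [A [[[A0 _] _] _] //|a u v Su Sv A PA].
by have [[[_ AL] _] _] := PA; apply: AL; [exact: Su | exact: Sv].
Qed.

Lemma sub_closed_lspan (S : set E) : S `<=` closed_lspan S.
Proof. exact: sub_gen_smallest. Qed.

Lemma closed_lspan_sub (S A : set E) :
  closed_subspace A -> S `<=` A -> closed_lspan S `<=` A.
Proof. exact: smallest_sub. Qed.

End projection_operator.

(** * Operators on subspaces *)

Section operators.
Context {R : realType}.
Implicit Types E F : hilbertType R.

Lemma linear_on0 E F (A : set E) (T : E -> F) :
  linear_subspace A -> linear_on A T -> T 0 = 0.
Proof.
move=> [A0 _] TL; apply: (addrI (T 0)); rewrite addr0.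
by rewrite -[X in X + _ = _]scale1r -TL // scale1r addr0.
Qed.

Lemma linear_onD E F (A : set E) (T : E -> F) u v :
  linear_on A T -> A u -> A v -> T (u + v) = T u + T v.
Proof. by move=> TL Au Av; rewrite -[u]scale1r TL // !scale1r. Qed.

Lemma linear_onB E F (A : set E) (T : E -> F) u v :
  linear_on A T -> A u -> A v -> T (u - v) = T u - T v.
Proof. by move=> TL Au Av; rewrite addrC -scaleN1r TL // scaleN1r addrC. Qed.

Lemma contraction_continuous E F (T : E -> F) :
  linear_on setT T -> (forall v, `|T v| <= `|v|) -> continuous T.
Proof.
move=> TL Tle v; apply/cvgrPdist_lt => e e0; near=> z.
rewrite -(linear_onB TL) //; apply: le_lt_trans (Tle _) _.
by near: z; exact: cvgr_dist_lt.
Unshelve. all: by end_near. Qed.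

Lemma dot_eq_norm E F (u : E) (v : F) : '[u, u] = '[v, v] -> `|u| = `|v|.
Proof.
by rewrite -!hdot_norm => /eqP; rewrite eqrXn2 // => /eqP.
Qed.

(** The difference of the two sesquilinear forms vanishes on the diagonal;
    evaluated at [c *: w + v] with [c = 1] and [c = 'i], this makes its
    symmetric and its antisymmetric part at [(v, w)] vanish. *)
Lemma polarization E F (A : set E) (q : E -> F) (T : E -> E) :
  linear_subspace A -> linear_on A q -> linear_on setT T ->
  (forall v, A v -> '[q v, q v] = '[T v, v]) ->
  forall v w, A v -> A w -> '[q v, q w] = '[T v, w].
Proof.
move=> [A0 AL] qL TL qT v w Av Aw.
pose X := '[q v, q w] - '[T v, w]; pose Y := '[q w, q v] - '[T w, v].
have key c : c * Y + Num.conj c * X = 0.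
  have := qT _ (AL c _ _ Aw Av); rewrite qL // TL //.
  rewrite !(dotDl, dotDr, dotZl, dotZr) !qT // => /eqP.
  rewrite -subr_eq0 => /eqP eq0; rewrite -[RHS]eq0 /X /Y; ring.
have := key 1; have := key 'i; rewrite conjC1 conjCi => ki k1.
apply/eqP; rewrite -subr_eq0; apply/eqP.
have : 'i * (2 * X) = 0.
  have -> : 'i * (2 * X) = 'i * (1 * Y + 1 * X) - ('i * Y + - 'i * X) by ring.
  by rewrite k1 ki mulr0 subrr.
by move/eqP; rewrite !mulf_eq0 (negPf (neq0Ci _)) pnatr_eq0 /= => /eqP.
Qed.

(** The range is complete: preimages of a sequence converging in the range
    form a Cauchy sequence in [A]. *)
Lemma isometry_surjective E F (A : set E) (T : E -> F) :
  closed_subspace A -> linear_on A T -> (forall v, A v -> `|T v| = `|v|) ->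
  dense (T @` A) -> T @` A = setT.
Proof.
move=> [lA cA] TL Tiso dT; apply/seteqP; split=> // y _.
have /choice[a aP] n : exists a, A a /\ `|y - T a| < (n.+1%:R^-1)%:C.
  have e0 : 0 < (n.+1%:R^-1 : R)%:C by rewrite ltcR invr_gt0.
  have [||z [yz [a Aa Taz]]] := dT (ball y (n.+1%:R^-1)%:C).
  - by exists y; exact: ballxx.
  - exact: ball_open.
  by exists a; split=> //; move: yz; rewrite -ball_normE -Taz.
have dist u v : A u -> A v -> `|u - v| = `|T u - T v|.
  by move=> Au Av; rewrite -(linear_onB TL) // Tiso //; exact: subspaceB.
have cv : cvg (a @ \oo).
  apply/cauchy_cvgP/cauchy_ballP => _ /gt0_real[r r0 ->].
  have r20 : 0 < r / 2 by rewrite divr_gt0.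
  near \oo => K.
  pose tail := [set a n | n in [set n | (K <= n)%N]].
  exists (tail, tail); first by split; exists K => // n Kn; exists n.
  move=> [_ _] /= [[n Kn <-] [m Km <-]].
  have [[An ltn] [Am ltm]] := (aP n, aP m).
  rewrite -ball_normE /= dist // -(subrKA y) addrC.
  apply: le_lt_trans (ler_normD _ _) _.
  rewrite [X in _ + X]distrC; apply: lt_trans (ltrD ltm ltn) _.
  rewrite -rmorphD /= ltcR.
  have le_inv k : (K <= k)%N -> (k.+1%:R^-1 : R) <= K.+1%:R^-1.
    by move=> Kk; rewrite lef_pV2 ?posrE // ler_nat.
  suff ltK : K.+1%:R^-1 < r / 2.
    rewrite [r]splitr; apply: le_lt_trans (lerD (le_inv _ Km) (le_inv _ Kn)) _.
    exact: ltrD.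
  near: K; exact: (near_infty_natSinv_lt (PosNum r20)).
have Al : A (lim (a @ \oo)).
  by apply: (closed_cvg _ cA _ _ cv); apply: nearW => n; case: (aP n).
set l := lim (a @ \oo) in Al.
exists l => //; apply/esym/eqP; rewrite -subr_eq0 -normr_le0.
apply/ler_addgt0Pr => _ /gt0_real[r r0 ->]; rewrite add0r.
have r20 : 0 < r / 2 by rewrite divr_gt0.
near \oo => n; have [An ltn] := aP n.
rewrite -(subrKA (T (a n))); apply: le_trans (ler_normD _ _) _.
rewrite -dist // [r]splitr rmorphD lerD //.
  apply: le_trans (ltW ltn) _; rewrite lecR ltW //.
  near: n; exact: (near_infty_natSinv_lt (PosNum r20)).
rewrite distrC ltW //; near: n; apply: cvgr_dist_lt => //.
by rewrite ltcR.
Unshelve. all: by end_near. Qed.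

End operators.

Section unitary_operators.
Context {R : realType} {E : hilbertType R}.
Implicit Types (u v w x y : E) (A : set E).

Lemma unitary_dot (T : E -> E) u v : unitary T -> '[T u, T v] = '[u, v].
Proof. by case=> _ + _; apply. Qed.

Lemma unitary_linear (T : E -> E) : unitary T -> linear_on setT T.
Proof. by case. Qed.

Lemma unitary_continuous (T : E -> E) : unitary T -> continuous T.
Proof.
move=> uT; apply: contraction_continuous (unitary_linear uT) _ => v.
by rewrite (@dot_eq_norm _ _ _ (T v) v) // unitary_dot.
Qed.

Lemma closed_subspace_preimage (T : E -> E) A :
  unitary T -> closed_subspace A -> closed_subspace (T @^-1` A).
Proof.
move=> uT [[A0 AL] cA]; have TL := unitary_linear uT; split; last first.
  by apply: preimage_closed => // x _; exact: unitary_continuous.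
split=> [|a u v Au Av]; last by rewrite /preimage /= TL //; exact: AL.
by rewrite /preimage /= (linear_on0 _ TL) //; split.
Qed.

Lemma image_involution (theta : E -> E) A :
  involutive theta -> theta @` A = theta @^-1` A.
Proof.
move=> thetaK; apply/seteqP; split=> [_ [v Av <-]|v Av].
  by rewrite /preimage /= thetaK.
by exists (theta v).
Qed.

End unitary_operators.

(** * The Markov property of a theta-positive subspace *)

Section reflection_positive_spaces.
Context {R : realType} {E : hilbertType R}.
Implicit Types (u v w x y : E) (A B : set E).

(** The Cauchy-Schwarz inequality for the form ['[theta v, w]], in the
    degenerate case: with [c = s * '[theta v, n]] and [0 <= s], positivity at
    [v - c *: n] reads [0 <= '[theta v, v] - 2 * s * `|'[theta v, n]| ^+ 2],
    which fails for large [s] unless ['[theta v, n] = 0]. *)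
Lemma neutral_orthogonal (theta : E -> E) A v n :
  linear_on setT theta -> (forall v w, '[theta v, w] = '[v, theta w]) ->
  linear_subspace A -> theta_positive theta A ->
  A v -> A n -> '[theta n, n] = 0 -> '[theta v, n] = 0.
Proof.
move=> thetaL theta_sym lA Apos Av An nn0.
set b := '[theta v, n]; apply/eqP; apply: contraT => b0.
have bb0 : 0 < `|b| ^+ 2 by rewrite exprn_gt0 // normr_gt0.
have vv0 : 0 <= '[theta v, v] by exact: Apos.
(* With this [s] the right hand side of the inequality is [-1]. *)
pose s := ('[theta v, v] + 1) / (2 * `|b| ^+ 2).
have s0 : 0 <= s by rewrite divr_ge0 ?addr_ge0 // mulr_ge0 // ltW.
have := Apos (- (s * b) *: n + v) _.
have sJ : Num.conj s = s by apply: conj_Creal; exact: ger0_real.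
have nvE : '[theta n, v] = Num.conj b by rewrite theta_sym dotC.
have -> : '[theta (- (s * b) *: n + v), - (s * b) *: n + v] = -1.
  rewrite thetaL // !(dotDl, dotDr, dotZl, dotZr) nn0 nvE -/b.
  rewrite rmorphN rmorphM /= sJ.
  have -> : '[theta v, v] = 2 * s * `|b| ^+ 2 - 1.
    by rewrite mulrAC mulrC divfK ?addrK // mulf_neq0 // gt_eqF.
  by rewrite normCK; ring.
by rewrite oppr_ge0 ler10; apply; case: lA => _; apply.
Qed.

Variables (theta : E -> E) (K : set E).
Hypothesis rps : reflection_positive_space theta K.
Local Notation E0 := (fixed_part theta K).
Local Notation N := (null_part theta K).

Let thetaU : unitary theta := rps_unitary rps.
Let thetaK : involutive theta := rps_involutive rps.
Let thetaL : linear_on setT theta := unitary_linear thetaU.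
Let cK : closed_subspace K := rps_closed_subspace rps.
Let Kpos : theta_positive theta K := rps_positive rps.

Lemma theta_sym v w : '[theta v, w] = '[v, theta w].
Proof. by rewrite -(unitary_dot v _ thetaU) thetaK. Qed.

Lemma fixed_part_closed : closed_subspace E0.
Proof.
suff -> : E0 = K `&` perp (range (fun w => w - theta w)).
  by apply: closed_subspaceI => //; exact: closed_subspace_perp.
apply/seteqP; split=> v [Kv].
  by move=> thv; split=> // _ [w _ <-]; rewrite dotBr -theta_sym thv subrr.
move=> vP; split=> //; apply/eqP; rewrite -subr_eq0; apply/eqP/dot_eq0.
have /vP : range (fun w => w - theta w) (v - theta v) by exists v.
move=> vd; rewrite dotBl theta_sym (linear_onB thetaL) // thetaK.
by rewrite -[theta v - v]opprB dotNr vd oppr0 subr0.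
Qed.

Lemma null_part_orthogonal n v : N n -> K v -> '[n, theta v] = 0.
Proof.
move=> [Kn nn0] Kv; apply: dot_eq0C.
by apply: (neutral_orthogonal thetaL theta_sym cK.1 Kpos).
Qed.

Lemma null_part_closed : closed_subspace N.
Proof.
suff -> : N = K `&` perp (theta @` K).
  by apply: closed_subspaceI => //; exact: closed_subspace_perp.
apply/seteqP; split=> n [Kn nP]; split=> //.
  by move=> _ [v Kv <-]; exact: null_part_orthogonal.
by apply: dot_eq0C; apply: nP; exists n.
Qed.

Lemma null_part_fixed n e : N n -> E0 e -> '[n, e] = 0.
Proof. by move=> Nn [Ke <-]; exact: null_part_orthogonal. Qed.

(** The condition on which the equivalence turns: conditionally on [E0], the
    future [K] and the past [theta K] are uncorrelated. *)
Definition markov :=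
  forall v w, K v -> perp E0 v -> K w -> '[v, theta w] = 0.

Definition theta_total :=
  forall x, (forall w, K w -> '[x, w] = 0) ->
    (forall w, K w -> '[x, theta w] = 0) -> x = 0.

Lemma markov_null v : markov -> K v -> perp E0 v -> N v.
Proof. by move=> mK Kv vP; split=> //; apply: dot_eq0C; exact: mK. Qed.

Lemma fixed_residual v : K v ->
  [/\ E0 (orthproj E0 v), K (v - orthproj E0 v) &
      perp E0 (v - orthproj E0 v)].
Proof.
move=> Kv; have [E0p pP] := orthprojP v fixed_part_closed.
by split=> //; apply: subspaceB => //; [exact: cK.1 | case: E0p].
Qed.

(** [K] is the sum of [E0] and [N], so a vector orthogonal to [N], [E0] and
    [theta N] is orthogonal to [K] and to [theta K]; totality makes the
    residual of [x] after the three projections vanish. *)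
Lemma markov_decomposition : markov -> theta_total ->
  orthogonal_decomposition3 N E0 (theta @` N).
Proof.
move=> mK total; have cN := null_part_closed; have cE := fixed_part_closed.
have cM : closed_subspace (theta @` N).
  by rewrite image_involution //; exact: closed_subspace_preimage.
have oNE n e : N n -> E0 e -> '[n, e] = 0 by exact: null_part_fixed.
have oNM n m : N n -> (theta @` N) m -> '[n, m] = 0.
  by move=> Nn [k [Kk _] <-]; exact: null_part_orthogonal.
have oEM e m : E0 e -> (theta @` N) m -> '[e, m] = 0.
  move=> Ee [k Nk <-]; rewrite -theta_sym; case: (Ee) => _ ->.
  by apply: dot_eq0C; exact: oNE.
split; [by [] | by [] |] => x.
have [Na aP] := orthprojP x cN; have [Eb bP] := orthprojP x cE.
have [Mc cP] := orthprojP x cM.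
set a := orthproj N x in Na aP; set b := orthproj E0 x in Eb bP.
set c := orthproj _ x in Mc cP.
exists a, b, c; split=> //; apply/eqP; rewrite -subr_eq0; apply/eqP.
have yN n : N n -> '[x - (a + b + c), n] = 0.
  move=> Nn; rewrite -addrA opprD addrA dotBl aP // dotDl.
  by rewrite (dot_eq0C (oNE _ _ Nn Eb)) (dot_eq0C (oNM _ _ Nn Mc)) addr0 subr0.
have yE e : E0 e -> '[x - (a + b + c), e] = 0.
  move=> Ee; rewrite [a + b]addrC -addrA opprD addrA dotBl bP // dotDl.
  by rewrite (oNE _ _ Na Ee) (dot_eq0C (oEM _ _ Ee Mc)) addr0 subr0.
have yM m : (theta @` N) m -> '[x - (a + b + c), m] = 0.
  move=> Mm; rewrite [_ + c]addrC opprD addrA dotBl cP // dotDl.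
  by rewrite (oNM _ _ Na Mm) (oEM _ _ Eb Mm) addr0 subr0.
apply: total => w Kw; have [Ee Kn nP] := fixed_residual Kw;
    have Nn := markov_null mK Kn nP.
  by rewrite -(subrK (orthproj E0 w) w) dotDr yN // yE // addr0.
rewrite -(subrK (orthproj E0 w) w) (linear_onD thetaL) // dotDr.
rewrite yM; last by exists (w - orthproj E0 w).
by case: (Ee) => _ ->; rewrite yE // addr0.
Qed.

(** Write [v] in [B] as [a + b + theta m] along the decomposition.  Since
    [m] is neutral in [B], it is orthogonal to [theta v], which means that
    ['[theta m, theta m] = 0]. *)
Lemma markov_maximal : markov -> theta_total -> maximal_theta_positive theta K.
Proof.
move=> mK total; split; [exact: cK.1 | by [] |] => B lB Bpos KB.
apply/seteqP; split=> // v Bv.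
have [_ [oNE oNM oEM] dec] := markov_decomposition mK total.
have [a [b [_ [Na Eb [m Nm <-] vE]]]] := dec v.
have Mm : (theta @` N) (theta m) by exists m.
have : '[theta v, m] = 0.
  apply: (neutral_orthogonal thetaL theta_sym lB Bpos) => //.
    by apply: KB; case: Nm.
  by case: Nm.
rewrite theta_sym vE !dotDl (oNM _ _ Na Mm) (oEM _ _ Eb Mm) !add0r.
move=> /dot_eq0 ->; rewrite addr0.
by apply: subspaceD; [exact: cK.1 | case: Na | case: Eb].
Qed.

Lemma fixed_orthproj_theta w : orthproj E0 (theta w) = orthproj E0 w.
Proof.
have [Ee eP] := orthprojP w fixed_part_closed.
apply: orthproj_eq => //; first exact: fixed_part_closed.1.
move=> z Ez; case: (Ez) => _ <-; rewrite dotBl theta_sym thetaK.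
by case: (Ez) => _ ->; rewrite -dotBl eP.
Qed.

(** As [P0] has range in [K], and [P0 (theta w) = P0 w], the identity
    evaluated at [theta w] says that [P0 w] is the projection of [theta w]
    to [K]. *)
Lemma markov_projections :
  markov <-> orthproj K \o orthproj E0 \o orthproj (theta @` K) =
             orthproj K \o orthproj (theta @` K).
Proof.
have cT : closed_subspace (theta @` K).
  by rewrite image_involution //; exact: closed_subspace_preimage.
split=> [mK|PPP v w Kv vP Kw].
  apply/funext => x /=; have [[w Kw <-] _] := orthprojP x cT.
  rewrite fixed_orthproj_theta; have [Ee Kn nP] := fixed_residual Kw.
  have Ke : K (orthproj E0 w) by case: Ee.
  rewrite (orthproj_eq cK.1 Ke); last by move=> z _; rewrite subrr dot0l.
  apply/esym; apply: (orthproj_eq cK.1 Ke) => v Kv.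
  by case: (Ee) => _ <-; rewrite -(linear_onB thetaL) // theta_sym mK.
have Tw : (theta @` K) (theta w) by exists w.
have := congr1 (fun f => f (theta w)) PPP; rewrite /=.
rewrite (orthproj_eq cT.1 Tw); last by move=> z _; rewrite subrr dot0l.
have [Ee eP] := orthprojP (theta w) fixed_part_closed.
have Ke : K (orthproj E0 (theta w)) by case: Ee.
rewrite (orthproj_eq cK.1 Ke); last by move=> z _; rewrite subrr dot0l.
have [_ pP] := orthprojP (theta w) cK.
move=> PE; rewrite -PE in pP.
rewrite -[theta w](subrK (orthproj E0 (theta w))) dotDr (vP _ Ee) addr0.
by apply: dot_eq0C; exact: pP.
Qed.

End reflection_positive_spaces.

(** * The completion *)

Section completions.
Context {R : realType} {E F : hilbertType R}.
Implicit Types (v w x : E).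
Variables (theta : E -> E) (Ep : set E) (q : E -> F).
Hypothesis rps : reflection_positive_space theta Ep.
Hypothesis cpl : is_completion theta Ep q.
Local Notation E0 := (fixed_part theta Ep).

Let cEp : closed_subspace Ep := rps_closed_subspace rps.
Let cE0 : closed_subspace E0 := fixed_part_closed rps.
Let thetaL : linear_on setT theta := unitary_linear (rps_unitary rps).

Lemma completion_dot v w : Ep v -> Ep w -> '[q v, q w] = '[theta v, w].
Proof.
apply: (polarization cEp.1 (completion_linear cpl) thetaL) => {}v Ev.
by rewrite -hdot_norm (completion_norm cpl) // sqrtCK.
Qed.

Lemma completion_linear_fixed : linear_on E0 q.
Proof.
by move=> a v w [Ev _] [Ew _]; exact: (completion_linear cpl).
Qed.

Lemma completion_dot_fixed v w : E0 v -> Ep w -> '[q v, q w] = '[v, w].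
Proof. by move=> [Ev thv] Ew; rewrite completion_dot // thv. Qed.

Lemma completion_null n v : null_part theta Ep n -> Ep v -> q (v + n) = q v.
Proof.
move=> [En nn0] Ev; rewrite (linear_onD (completion_linear cpl)) //.
suff -> : q n = 0 by rewrite addr0.
by apply: dot_eq0; rewrite completion_dot.
Qed.

(** If [q e = q v] with [e] in [E0] and [v] orthogonal to [E0], then [v - e]
    is orthogonal to [theta Ep], in particular to [e = theta e], so
    [e = 0]. *)
Lemma markov_completion : markov theta Ep <-> q @` E0 = setT.
Proof.
split=> [mE|surj v w Ev vP Ew].
  apply: (isometry_surjective cE0 completion_linear_fixed).
    move=> v Ev; apply: dot_eq_norm.
    by rewrite completion_dot_fixed //; case: Ev.
  suff -> : q @` E0 = q @` Ep by exact: completion_dense cpl.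
  apply/seteqP; split=> [_ [v [Ev _] <-]|_ [v Ev <-]]; first by exists v.
  have [Ee Kn nP] := fixed_residual rps Ev.
  exists (orthproj E0 v) => //.
  rewrite -[in RHS](subrK (orthproj E0 v) v) addrC completion_null //.
    exact: markov_null.
  by case: Ee.
have /seteqP[_ /(_ (q v) I)[e Ee qe]] := surj.
have Ee' : Ep e by case: Ee.
have vew : '[v - e, theta w] = 0.
  rewrite -(theta_sym rps) (linear_onB thetaL) // dotBl -!completion_dot //.
  by rewrite qe subrr.
have ve0 : '[e, e] = 0.
  have := completion_dot_fixed Ee Ev; rewrite -qe completion_dot_fixed // => ->.
  by apply: dot_eq0C; exact: vP.
by move: vew; rewrite (dot_eq0 ve0) subr0.
Qed.

Lemma unitary_completion : q @` E0 = setT <-> unitary_on E0 q.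
Proof.
split=> [surj|[]//]; split=> //; first exact: completion_linear_fixed.
by move=> v w Ev Ew; apply: completion_dot_fixed => //; case: Ew.
Qed.

Lemma completion_contraction v : Ep v -> `|q v| <= `|v|.
Proof.
move=> Ev; rewrite -(@ler_pXn2r _ 2) ?nnegrE // hdot_norm completion_dot //.
rewrite -[leLHS]ger0_norm; last exact: rps_positive rps _ Ev.
apply: le_trans (cauchy_schwarz _ _) _.
rewrite (@dot_eq_norm _ _ _ (theta v) v) ?expr2 //.
by rewrite unitary_dot //; exact: rps_unitary rps.
Qed.

Lemma adjoint_fixedE x (y : F) : E0 x ->
  (forall w, E0 w -> '[x, w] = '[y, q w]) -> adjoint_on E0 q y = x.
Proof.
move=> Ex xP.
have [Ez zP] := @xgetPex _ 0
  [set x | E0 x /\ forall w, E0 w -> '[x, w] = '[y, q w]]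
  (ex_intro _ x (conj Ex xP)).
rewrite -/(adjoint_on E0 q y) in Ez zP.
apply/eqP; rewrite -subr_eq0; apply/eqP/dot_eq0.
have Ed : E0 (adjoint_on E0 q y - x) by exact: subspaceB cE0.1 _ _.
by rewrite dotBl zP // xP // subrr.
Qed.

End completions.

(** * Reflection positive one-parameter groups *)

Section reflection_positive_groups.
Context {R : realType} {E : hilbertType R}.
Implicit Types (u v w x y : E) (s t : R).
Variables (theta : E -> E) (Ep : set E) (U : R -> E -> E).
Hypothesis rps : reflection_positive_space theta Ep.
Hypothesis rpg : reflection_positive_group theta Ep U.
Local Notation E0 := (fixed_part theta Ep).

Let grp : unitary_one_parameter_group U := rpg_group rpg.
Let cEp : closed_subspace Ep := rps_closed_subspace rps.
Let cE0 : closed_subspace E0 := fixed_part_closed rps.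
Let fixE v : E0 v -> theta v = v. Proof. by case. Qed.

Lemma groupNK t v : U (- t) (U t v) = v.
Proof.
by rewrite -[LHS]/((U (- t) \o U t) v) -(groupD grp) addNr (group0 grp).
Qed.

Lemma group_adjoint t v w : '[U t v, w] = '[v, U (- t) w].
Proof. by rewrite -(unitary_dot _ w (group_unitary grp (- t))) groupNK. Qed.

Lemma theta_group t v : theta (U t v) = U (- t) (theta v).
Proof. by rewrite -(rpg_reflection rpg) /= (rps_involutive rps). Qed.

Lemma group_fixed t v : E0 v -> theta (U t v) = U (- t) v.
Proof. by move=> Ev; rewrite theta_group fixE. Qed.

Lemma group_invariant t v : 0 <= t -> Ep v -> Ep (U t v).
Proof.
rewrite le_eqVlt => /predU1P[<-|t0] Ev; first by rewrite (group0 grp).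
by apply: (rpg_invariant rpg t0); exists v.
Qed.

(** The orbit for negative times lies in [theta K], because
    [U (- t) v = theta (U t v)] for [v] in [E0]. *)
Lemma cyclic_total (K : set E) : cyclic_subspace U E0 ->
  (forall t v, 0 <= t -> E0 v -> K (U t v)) -> theta_total theta K.
Proof.
move=> cyc UK x xK xTK; apply: (perp_dense_eq0 cyc) => _ [t _ [v Ev <-]].
have [t0|t0] := leP 0 t; first by rewrite xK //; exact: UK.
rewrite -[t]opprK -group_fixed // xTK //; apply: UK => //.
by rewrite oppr_ge0 ltW.
Qed.

(** [U s] maps [n = U t v - P0 (U t v)] to a vector orthogonal to [E0], as
    ['[U s n, w] = '[n, theta (U s w)]] for [w] in [E0]. *)
Lemma markov_multiplicative : markov theta Ep ->
  forall s t, 0 < s -> 0 < t -> forall v, E0 v ->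
    compression E0 U (s + t) v = compression E0 U s (compression E0 U t v).
Proof.
move=> mE s t s0 t0 v Ev; rewrite /compression (groupD grp) /=.
set y := U t v.
have Ey : Ep y by apply: group_invariant; [exact: ltW | case: Ev].
have [Ep0 Kn nP] := fixed_residual rps Ey.
have [Ez zP] := orthprojP (U s (orthproj E0 y)) cE0.
apply: (orthproj_eq cE0.1 Ez) => w Ew.
rewrite -(subrKA (U s (orthproj E0 y))) dotDl zP // addr0.
rewrite -(linear_onB (unitary_linear (group_unitary grp s))) // group_adjoint.
rewrite -group_fixed //; apply: mE => //.
by apply: group_invariant; [exact: ltW | case: Ew].
Qed.

Local Notation S := (\bigcup_(t in [set t : R | 0 < t]) (U t @` E0)).

Lemma forward_span_sub : closed_lspan S `<=` Ep.
Proof.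
apply: closed_lspan_sub => // _ [t t0 [v Ev <-]].
by apply: group_invariant; [exact: ltW | case: Ev].
Qed.

(** Time [0], excluded from the generators, is recovered by strong
    continuity. *)
Lemma forward_span_orbit t v : 0 <= t -> E0 v -> closed_lspan S (U t v).
Proof.
have SU s w : 0 < s -> E0 w -> closed_lspan S (U s w).
  by move=> s0 Ew; apply: sub_closed_lspan; exists s => //; exists w.
rewrite le_eqVlt => /predU1P[<-|t0] Ev; last exact: SU.
have Uv0 := cvg_at_right_filter (@group_strongly_continuous _ _ _ grp v 0).
apply: (closed_cvg _ (closed_subspace_closed_lspan S).2 _ _ Uv0).
by near=> s; apply: SU => //; near: s; exact: nbhs_right_gt.
Unshelve. all: by end_near. Qed.

Lemma forward_span_rps : reflection_positive_space theta (closed_lspan S).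
Proof.
split; [exact: rps_unitary rps | exact: rps_involutive rps | |].
  exact: closed_subspace_closed_lspan.
by move=> v /forward_span_sub; exact: (rps_positive rps).
Qed.

Lemma forward_span_fixed : fixed_part theta (closed_lspan S) = E0.
Proof.
apply/seteqP; split=> v [Fv thv]; split=> //; first exact: forward_span_sub.
have <- : U 0 v = v by rewrite (group0 grp).
by apply: forward_span_orbit => //; split.
Qed.

(** Multiplicativity is the orthogonality of [U t a - P0 (U t a)] and
    [theta (U s c)] for generators [U t a] and [U s c]; it extends to the
    closed span in the second variable, then in the first one. *)
Lemma multiplicative_forward_markov :
  (forall s t, 0 < s -> 0 < t -> forall v, E0 v ->
    compression E0 U (s + t) v = compression E0 U s (compression E0 U t v)) ->
  markov theta (closed_lspan S).
Proof.
rewrite /markov forward_span_fixed => mul v w Fv vP Fw.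
(* Moving the projection to the second argument turns the claim into the
   orthogonality of [v] to a fixed vector, which is a closed condition. *)
have [Ee eP] := orthprojP (theta w) cE0; set e := orthproj _ _ in Ee eP.
suff : '[v, theta w - e] = 0 by rewrite dotBr (vP _ Ee) subr0.
suff FP : closed_lspan S `<=` perp [set theta w - e] by exact: FP.
apply: closed_lspan_sub => [|_ [t t0 [a Ea <-]] _ ->].
  exact: closed_subspace_perp.
have [Eb bP] := orthprojP (U t a) cE0; set b := orthproj _ _ in Eb bP.
suff wb : '[U t a - b, theta w] = 0.
  have : '[U t a - b, theta w - e] = 0 by rewrite dotBr wb (bP _ Ee) subrr.
  by rewrite dotBl [X in _ - X](dot_eq0C (eP _ Eb)) subr0.
rewrite -(theta_sym rps); apply: dot_eq0C.
suff FP : closed_lspan S `<=` perp [set theta (U t a - b)] by exact: FP.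
apply: closed_lspan_sub => [|_ [s s0 [c Ec <-]] _ ->].
  exact: closed_subspace_perp.
apply: dot_eq0C; rewrite (theta_sym rps) group_fixed // -group_adjoint.
rewrite (linear_onB (unitary_linear (group_unitary grp s))) //.
have proj x : '[x, c] = '[orthproj E0 x, c].
  by apply/eqP; rewrite -subr_eq0 -dotBl (orthprojP x cE0).2.
rewrite dotBl proj [X in _ - X]proj.
have := mul s t s0 t0 a Ea; rewrite /compression (groupD grp) /= => ->.
by rewrite subrr.
Qed.

(** The closed span on the right is a Markov space by the previous lemma,
    hence maximal theta-positive, while [Ep] is theta-positive and contains
    it. *)
Lemma multiplicative_forward_eq : cyclic_subspace U E0 ->
  (forall s t, 0 < s -> 0 < t -> forall v, E0 v ->
    compression E0 U (s + t) v = compression E0 U s (compression E0 U t v)) ->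
  Ep = closed_lspan S.
Proof.
move=> cyc mul; have mF := multiplicative_forward_markov mul.
have tF : theta_total theta (closed_lspan S).
  by apply: cyclic_total cyc _ => t v; exact: forward_span_orbit.
have [_ _ maxF] := markov_maximal forward_span_rps mF tF.
apply: maxF; first exact: cEp.1.
  exact: rps_positive rps.
exact: forward_span_sub.
Qed.

Lemma compressionN t v : E0 v ->
  compression E0 U (- t) v = compression E0 U t v.
Proof.
by move=> Ev; rewrite /compression /= -group_fixed // fixed_orthproj_theta.
Qed.

(** For [n] null, ['[theta (U t n), U t n] = '[n, theta (U (t + t) n)]], and
    [n] is orthogonal to [theta Ep]. *)
Lemma null_part_invariant t n : 0 <= t ->
  null_part theta Ep n -> null_part theta Ep (U t n).
Proof.
move=> t0 Nn; case: (Nn) => En _; have EU := group_invariant t0 En.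
split=> //; rewrite (theta_sym rps) group_adjoint -theta_group.
by apply: (null_part_orthogonal rps Nn); exact: group_invariant.
Qed.

Variables (F : hilbertType R) (q : E -> F).
Hypothesis cpl : is_completion theta Ep q.

Lemma completion_compression t v : markov theta Ep -> 0 <= t -> E0 v ->
  q (compression E0 U t v) = q (U t v).
Proof.
move=> mE t0 Ev; have EU : Ep (U t v) by apply: group_invariant => //; case: Ev.
have [[Ee _] Kn nP] := fixed_residual rps EU.
rewrite -[in RHS](subrK (orthproj E0 (U t v)) (U t v)) addrC.
by rewrite (completion_null rps cpl) //; exact: markov_null.
Qed.

(** The operator required by the definition exists: transport [U t] through
    a right inverse [g] of [q] with values in [E0]; the choice of
    representatives is harmless since [U t] preserves null vectors. *)
Lemma induced_semigroupE t v : q @` E0 = setT -> 0 <= t -> Ep v ->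
  induced_semigroup Ep q U t (q v) = q (U t v).
Proof.
move=> surj t0.
have /choice[g gP] (y : F) : exists v, E0 v /\ q v = y.
  by have /seteqP[_ /(_ y I)[e Ee qe]] := surj; exists e.
have gE (y : F) : E0 (g y) by case: (gP y).
have gEp (y : F) : Ep (g y) by case: (gE y).
have qg (y : F) : q (g y) = y by case: (gP y).
have qU y : Ep y -> q (U t (g (q y))) = q (U t y).
  move=> Ey; have Ed : Ep (y - g (q y)) by exact: subspaceB cEp.1 _ _.
  have Nd : null_part theta Ep (y - g (q y)).
    split=> //; rewrite -(completion_dot rps cpl) //.
    by rewrite (linear_onB (completion_linear cpl)) // qg subrr dot0l.
  rewrite -[in RHS](subrK (g (q y)) y) addrC.
  rewrite (linear_onD (unitary_linear (group_unitary grp t))) //.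
  rewrite (completion_null rps cpl) //; first exact: null_part_invariant.
  exact: group_invariant.
pose T (y : F) := q (U t (g y)).
have TL : linear_on setT T.
  move=> a y z _ _; rewrite /T -[in LHS](qg y) -[in LHS](qg z).
  rewrite -(completion_linear cpl) // qU; last by case: cEp.1 => _; apply.
  rewrite (unitary_linear (group_unitary grp t)) //.
  by rewrite (completion_linear cpl) //; exact: group_invariant.
suff : exists T : F -> F, [/\ linear T, continuous T &
    forall v, Ep v -> T (q v) = q (U t v)].
  move=> exT Ev.
  by have [_ _] := @xgetPex (F -> F) id [set T : F -> F | _] exT; apply.
exists T; split=> // [a y z|].
  by rewrite TL.
apply: (contraction_continuous TL) => y.
apply: le_trans (completion_contraction rps cpl (group_invariant t0 (gEp y))) _.
rewrite le_eqVlt; apply/orP; left; apply/eqP; apply: dot_eq_norm.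
rewrite unitary_dot; last exact: group_unitary grp t.
by rewrite -(completion_dot_fixed rps cpl) // qg.
Qed.

Lemma compression_adjoint t v : q @` E0 = setT -> E0 v ->
  compression E0 U t v = adjoint_on E0 q (induced_semigroup Ep q U `|t| (q v)).
Proof.
move=> surj Ev; have Ev' : Ep v by case: Ev.
rewrite induced_semigroupE //.
have -> : compression E0 U t v = compression E0 U `|t| v.
  have [t0|t0] := leP 0 t; first by rewrite ger0_norm.
  by rewrite ltr0_norm // compressionN.
have [Ec cP] := orthprojP (U `|t| v) cE0.
apply/esym/(adjoint_fixedE rps) => // w Ew; have Ew' : Ep w by case: Ew.
rewrite (completion_dot rps cpl) //; last exact: group_invariant.
rewrite (theta_sym rps) fixE //; apply/esym/eqP.
by rewrite -subr_eq0 -dotBl cP.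
Qed.

End reflection_positive_groups.

(** * The equivalence and its consequences *)

Unset Implicit Arguments.

Theorem proposition3p17 (R : realType) (E Ehat : hilbertType R)
    (theta : E -> E) (Ep : set E) (U : R -> E -> E) (q : E -> Ehat) :
  reflection_positive_space theta Ep ->
  reflection_positive_group theta Ep U ->
  is_completion theta Ep q ->
  let E0 := fixed_part theta Ep in
  let N := null_part theta Ep in
  let phi := compression E0 U in
  let Uhat := induced_semigroup Ep q U in
  let Gammastar := adjoint_on E0 q in
  let Pplus := orthproj Ep in
  let P0 := orthproj E0 in
  let Pminus := orthproj (theta @` Ep) in
  cyclic_subspace U E0 ->
  [<-> q @` E0 = setT;
       unitary_on E0 q;
       forall s t : R, 0 < s -> 0 < t ->
         forall v, E0 v -> phi (s + t) v = phi s (phi t v);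
       Pplus \o P0 \o Pminus = Pplus \o Pminus]
  /\
  (q @` E0 = setT ->
   [/\ forall (t : R) v, E0 v -> phi t v = Gammastar (Uhat `|t| (q v)),
       forall (t : R) v, 0 < t -> E0 v -> q (phi t v) = Uhat t (q v),
       orthogonal_decomposition3 N E0 (theta @` N),
       maximal_theta_positive theta Ep &
       Ep = closed_lspan (\bigcup_(t in [set t : R | 0 < t]) (U t @` E0))]).
Proof.
move=> rps rpg cpl E0 N phi Uhat Gammastar Pplus P0 Pminus cyc.
have cpE := markov_completion rps cpl.
have prE := markov_projections rps.
have mulP := multiplicative_forward_eq rps rpg cyc.
have totE : theta_total theta Ep.
  apply: (cyclic_total rps rpg cyc) => t v t0 [Ev _].
  exact: (group_invariant rpg).
split.
  split.
    by move/(unitary_completion rps cpl).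
  split.
    by move/(unitary_completion rps cpl)/cpE/(markov_multiplicative rps rpg).
  split.
    move=> mul; apply/prE; rewrite /markov.
    have := multiplicative_forward_markov rps rpg mul.
    by rewrite -(mulP mul).
  by move=> /prE/cpE.
move=> surj; have /cpE mE := surj; split.
- by move=> t v; exact: (compression_adjoint rps rpg cpl).
- move=> t v t0 Ev; rewrite (completion_compression rps rpg cpl) ?ltW //.
  by rewrite /Uhat (induced_semigroupE rps rpg cpl) ?ltW //; case: Ev.
- exact: (markov_decomposition rps).
- exact: (markov_maximal rps).
- by apply: mulP; exact: (markov_multiplicative rps rpg).
Qed.
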